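(* Let $1\le d\le n$ be integers and let $A_1,\dots,A_n\ge 0$ be positive bounded operators on a Hilbert space $H$. Then $$\|P_d(A_1,\dots,A_n)\|^{1/d}\le d\,\|P_1(A_1,\dots,A_n)\|,$$ where $\|\cdot\|$ is the operator norm on $B(H)$.
   Context: For bounded operators $A_1,\dots,A_n$ and $1\le d\le n$, $$P_d(A_1,\dots,A_n)=\frac{(n-d)!}{n!}\sum_{\substack{1\le j_1,\dots,j_d\le n\\ \text{all different}}}A_{j_1}A_{j_2}\cdots A_{j_d}.$$ In particular $P_1(A_1,\dots,A_n)=\frac1n\sum_{j=1}^n A_j$. ''Positive'' means positive semidefinite. *)

(* Defs.v *)
From HB Require Import structures.
From mathcomp Require Import all_boot all_order all_algebra.
From mathcomp Require Import complex.
From mathcomp Require Import all_classical all_reals all_analysis.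
Set Implicit Arguments.
Unset Strict Implicit.
Unset Printing Implicit Defensive.
Import Order.TTheory GRing.Theory Num.Theory.
Import numFieldNormedType.Exports.
Local Open Scope classical_set_scope.
Local Open Scope ring_scope.
Local Open Scope complex_scope.

(* Complex Hilbert spaces, of arbitrary dimension. The inner product is linear
   in its first argument and conjugate-linear in the second one. *)
HB.mixin Record isHilbert (R : realType) (H : Type)
    & CompleteNormedModule R[i] H := {
  inner : {dot H for Num.conj} ;
  inner_norm : forall x : H, `|x| ^+ 2 = inner x x
}.

#[short(type="hilbertType")]
HB.structure Definition Hilbert (R : realType) :=
  {H of CompleteNormedModule R[i] H & isHilbert R H}.

Section Operators.
Variables (R : realType) (H : hilbertType R).

Definition bounded_op (T : {linear H -> H}) : Prop :=
  bounded_near T (nbhs (0 : H)).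

(* On R[i], [0 <= z] means that z is real and nonnegative; as the scalars are
   complex, self-adjointness of T is a consequence. *)
Definition positive_op (T : H -> H) : Prop := forall x, 0 <= inner (T x) x.

(* The norm of H takes its (real) values in R[i], hence the projection Re.
   The supremum is the operator norm when T is linear and bounded; it is 0 when
   H is trivial. *)
Definition opnorm (T : H -> H) : R :=
  sup [set complex.Re `|T x| | x in [set x : H | `|x| <= 1]].

(* Sum and scaling are the pointwise ones on H -> H; the iterated composition
   is A (j 0) \o A (j 1) \o ... \o A (j (d - 1)). *)
Definition nc_mean (n d : nat) (A : 'I_n -> {linear H -> H}) : H -> H :=
  ((n - d)`!%:R / n`!%:R : R[i]) *:
    \sum_(j : {ffun 'I_d -> 'I_n} | injectiveb j)
      \big[(fun S T : H -> H => S \o T)/idfun]_(k < d) (A (j k) : H -> H).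

End Operators.

(* Main.v *)
(* Let s be the norm of A_1 + ... + A_n. For signs e_i the operator
   B_e = sum_i e_i A_i satisfies -s <= B_e <= s as a quadratic form, so its
   norm is at most s. The sum G_d of the products A_{j_1} ... A_{j_d} over
   injective j, even with additional signs w_k(j_k), has norm at most d! s^d:
   for distinct j_1, ..., j_d, the indicator of "i is none of the j_k" is
   1 - sum_k [i = j_k], and [i = j_k] is the average of e_i e_{j_k} over all
   sign vectors e. Hence G_{d+1} is B G_d minus d averages of terms B_e G'_d,
   where G'_d is G_d with twisted signs, and the bound gains a factor
   (1 + d) s. The theorem follows from d! n^d <= d^d n! / (n - d)!. *)
From HB Require Import structures.
Require Import Defs.
From mathcomp Require Import all_boot all_order all_algebra.
From mathcomp Require Import ring complex.
From mathcomp Require Import all_classical all_reals all_analysis.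
Import Order.TTheory GRing.Theory Num.Theory.
Import numFieldNormedType.Exports.
Local Open Scope ring_scope.

Set Implicit Arguments.
Unset Strict Implicit.
Unset Printing Implicit Defensive.

(** * Sign averages and injective index sequences *)

Lemma sum_signs_delta (K : numFieldType) (n : nat) (i j : 'I_n) :
  \sum_(e : {ffun 'I_n -> bool}) (-1) ^+ e i * (-1) ^+ e j
    = (2 ^ n)%:R * (i == j)%:R :> K.
Proof.
have [<-|ij] := eqVneq i j.
  under eq_bigr do rewrite -expr2 sqrr_sign.
  by rewrite sumr_const card_ffun card_bool card_ord mulr1.
(* Off the diagonal, flipping the sign at [i] permutes the sign vectors and negates every summand,
   so the sum is its own opposite. *)
pose flip (e : {ffun 'I_n -> bool}) := [ffun k => (k == i) (+) e k].
have flipK : involutive flip.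
  by move=> e; apply/ffunP => k; rewrite !ffunE addKb.
set S := LHS; suff : S = - S.
  by move=> /eqP; rewrite -subr_eq0 opprK -mulr2n mulrn_eq0 /= mulr0 => /eqP.
rewrite {1}/S (reindex_inj (inv_inj flipK)) -sumrN; apply: eq_bigr => e _.
by rewrite !ffunE eqxx (negbTE (_ : j != i)) 1?eq_sym// signr_addb mulNr mul1r
   mulNr.
Qed.

Lemma sum_eq_codom (K : pzRingType) (d n : nat) (j : {ffun 'I_d -> 'I_n})
    (i : 'I_n) : injective j ->
  \sum_k (i == j k)%:R = (i \in codom j)%:R :> K.
Proof.
move=> jI; have [/codomP[k0 ->]|ij] := boolP (i \in codom j).
  rewrite (bigD1 k0)//= eqxx big1 ?addr0// => k kk0.
  by rewrite (inj_eq jI) eq_sym (negbTE kk0).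
rewrite big1// => k _; case: eqP => // ijk.
by rewrite ijk codom_f in ij.
Qed.

Definition ffun_cons (n d : nat) (i : 'I_n) (j : {ffun 'I_d -> 'I_n}) :=
  [ffun k : 'I_d.+1 => oapp j i (unlift ord0 k)].

Lemma ffun_cons0 (n d : nat) (i : 'I_n) (j : {ffun 'I_d -> 'I_n}) :
  ffun_cons i j ord0 = i.
Proof. by rewrite ffunE unlift_none. Qed.

Lemma ffun_consS (n d : nat) (i : 'I_n) (j : {ffun 'I_d -> 'I_n}) k :
  ffun_cons i j (lift ord0 k) = j k.
Proof. by rewrite ffunE liftK. Qed.

Lemma injectiveb_ffun_cons (n d : nat) (i : 'I_n) (j : {ffun 'I_d -> 'I_n}) :
  injectiveb (ffun_cons i j) = injectiveb j && (i \notin codom j).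
Proof.
apply/injectiveP/andP => [inj|[/injectiveP inj ij] k l].
  split; first apply/injectiveP => k l.
    by rewrite -!(ffun_consS i j) => /inj/lift_inj.
  apply/negP => /codomP[k]; rewrite -(ffun_consS i j) -{1}(ffun_cons0 i j).
  by move=> /inj.
case: (unliftP ord0 k) => [k' ->|->]; case: (unliftP ord0 l) => [l' ->|->] //;
  rewrite ?ffun_consS ?ffun_cons0.
- by move=> /inj ->.
- by move=> jk; move: ij; rewrite -jk codom_f.
- by move=> jk; move: ij; rewrite jk codom_f.
Qed.

(** Peels off the leftmost factor of a product; the constraint [i \notin codom j] that remains on it
    is what the sign averages will remove. *)
Lemma sum_injective_recl (V : nmodType) (n d : nat)
    (F : {ffun 'I_d.+1 -> 'I_n} -> V) :
  \sum_(j : {ffun 'I_d.+1 -> 'I_n} | injectiveb j) F j =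
  \sum_(j : {ffun 'I_d -> 'I_n} | injectiveb j)
    \sum_(i | i \notin codom j) F (ffun_cons i j).
Proof.
rewrite pair_big_dep /=.
rewrite (reindex (fun p : {ffun 'I_d -> 'I_n} * 'I_n => ffun_cons p.2 p.1)) /=.
  by apply: eq_bigl => p; rewrite injectiveb_ffun_cons.
exists (fun j => ([ffun k => j (lift ord0 k)], j ord0)) => [[j i] _|j _] /=.
  rewrite ffun_cons0; congr (_, _).
  by apply/ffunP => k; rewrite ffunE ffun_consS.
apply/ffunP => k; case: (unliftP ord0 k) => [l ->|->].
  by rewrite ffun_consS ffunE.
by rewrite ffun_cons0.
Qed.

(** * The recursion for signed sums over injective sequences, and its norm bound *)

Section SignedSums.
Variables (K : numFieldType) (V : normedModType K) (n : nat).
Variable A : 'I_n -> {linear V -> V}.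

Definition signed_sum (w : 'I_n -> bool) (x : V) : V :=
  \sum_i (-1) ^+ w i *: A i x.

Lemma signed_sum_is_linear w : linear (signed_sum w).
Proof.
move=> a x y; rewrite /signed_sum scaler_sumr -big_split; apply: eq_bigr => i _.
by rewrite linearP scalerDr !scalerA mulrC.
Qed.

HB.instance Definition _ w := GRing.isLinear.Build K V V _ (signed_sum w)
  (signed_sum_is_linear w).

Definition opprod d (j : {ffun 'I_d -> 'I_n}) : V -> V :=
  \big[(fun S T : V -> V => S \o T)/idfun]_(k < d) (A (j k) : V -> V).

Definition signed_inj_sum d (w : 'I_d -> 'I_n -> bool) (x : V) : V :=
  \sum_(j : {ffun 'I_d -> 'I_n} | injectiveb j)
    (\prod_k (-1) ^+ w k (j k)) *: opprod j x.

(** The sign [e (j l)] produced by an average is absorbed into the weight at position [l], so the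
    recursion stays among the sums [signed_inj_sum]. Signs are stored as exponents of -1, hence the
    exclusive or. *)
Definition twist d (w : 'I_d -> 'I_n -> bool) (l : 'I_d) (e : 'I_n -> bool) :=
  fun k i => w k i (+) ((k == l) && e i).

Lemma prod_twist d (w : 'I_d -> 'I_n -> bool) l e (j : 'I_d -> 'I_n) :
  \prod_k (-1) ^+ twist w l e k (j k) =
  (-1) ^+ e (j l) * \prod_k (-1) ^+ w k (j k) :> K.
Proof.
under eq_bigr do rewrite signr_addb mulrC.
rewrite big_split /=; congr (_ * _).
rewrite (bigD1 l)//= eqxx big1 ?mulr1// => k kl.
by rewrite (negbTE kl).
Qed.

Lemma signed_sum_inj_sum d (v : 'I_n -> bool) (w : 'I_d -> 'I_n -> bool) x :
  signed_sum v (signed_inj_sum w x) =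
  \sum_(j : {ffun 'I_d -> 'I_n} | injectiveb j) \sum_i
    ((-1) ^+ v i * \prod_k (-1) ^+ w k (j k)) *: A i (opprod j x).
Proof.
rewrite exchange_big; apply: eq_bigr => i _.
rewrite linear_sum scaler_sumr; apply: eq_bigr => j _.
by rewrite linearZ scalerA.
Qed.

(** In the average for [i = j k], the sign [e i] joins the outer weight and [e (j k)] goes into
    [twist]. The sum over [i] is then free of constraints and factors out as a [signed_sum]. *)
Lemma signed_inj_sum_recl d (w : 'I_d.+1 -> 'I_n -> bool) x :
  let w' k := w (lift ord0 k) in
  signed_inj_sum w x =
  signed_sum (w ord0) (signed_inj_sum w' x) -
  (2 ^ n)%:R^-1 *: \sum_k \sum_(e : {ffun 'I_n -> bool})
    signed_sum (fun i => w ord0 i (+) e i) (signed_inj_sum (twist w' k e) x).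
Proof.
move=> w'; rewrite {1}/signed_inj_sum sum_injective_recl.
under [X in _ - _ *: X]eq_bigr => k _ do
  (under eq_bigr do rewrite signed_sum_inj_sum; rewrite exchange_big /=).
rewrite exchange_big scaler_sumr /= signed_sum_inj_sum -sumrB.
apply: eq_bigr => j /injectiveP jI.
under [X in _ - _ *: X]eq_bigr => k _ do rewrite exchange_big /=.
rewrite exchange_big scaler_sumr /= -sumrB big_mkcond /=; apply: eq_bigr => i _.
under [X in _ - _ *: X]eq_bigr => k _ do rewrite -scaler_suml.
(* What remains is to compare the coefficients of [A i (opprod j x)] for fixed [i] and [j]. *)
rewrite -scaler_suml scalerA -scalerBl.
rewrite big_ord_recl ffun_cons0 /opprod big_ord_recl ffun_cons0 /=.
under eq_bigr do rewrite ffun_consS.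
under [in A i _]eq_bigr do rewrite ffun_consS.
set P := \prod__ _; set s := (-1) ^+ w ord0 i.
under [X in _ - _ * X]eq_bigr => k _.
  under eq_bigr => e _.
    rewrite prod_twist signr_addb -/P -/s.
    rewrite (_ : _ * _ = s * P * ((-1) ^+ e i * (-1) ^+ e (j k))); last by ring.
    over.
  rewrite -mulr_sumr sum_signs_delta.
  over.
rewrite -mulr_sumr -mulr_sumr sum_eq_codom//.
have n0 : (2 ^ n)%:R != 0 :> K by rewrite pnatr_eq0 expn_eq0.
have -> (b : bool) :
    (2 ^ n)%:R^-1 * (s * P * ((2 ^ n)%:R * b%:R)) = s * P * b%:R :> K.
  by field.
by case: (i \in codom j); rewrite /= ?mulr1 ?subrr ?scale0r// mulr0 subr0.
Qed.

(** Induction on [d], for all weights at once because the recursion twists them. *)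
Lemma signed_inj_sum_le (s : K) : 0 <= s ->
  (forall w x, `|signed_sum w x| <= s * `|x|) ->
  forall d (w : 'I_d -> 'I_n -> bool) x,
    `|signed_inj_sum w x| <= d`!%:R * s ^+ d * `|x|.
Proof.
move=> s0 hs; elim=> [|d IHd] w x.
  rewrite fact0 expr0 mulr1 mul1r /signed_inj_sum.
  (* The empty function is the only index, and its product is the identity. *)
  rewrite (big_pred1 (ffun0 (card_ord 0))) => [|j].
    by rewrite big_ord0 scale1r /opprod big_ord0.
  have -> : j = ffun0 (card_ord 0) by apply/ffunP => -[].
  by rewrite /= eqxx; apply/injectiveP => -[].
rewrite signed_inj_sum_recl; set w' := fun k => _.
set b := d`!%:R * s ^+ d * `|x|.
have le_b v u : `|signed_sum v (@signed_inj_sum d u x)| <= s * b.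
  by apply: le_trans (hs _ _) _; rewrite ler_wpM2l// IHd.
have -> : d.+1`!%:R * s ^+ d.+1 * `|x| = s * b + d%:R * (s * b).
  by rewrite /b factS natrM exprS -natr1; ring.
apply: le_trans (ler_normB _ _) _; apply: lerD; first exact: le_b.
have n0 : 0 < (2 ^ n)%:R :> K by rewrite ltr0n expn_gt0.
rewrite normrZ (@ger0_norm _ (2 ^ n)%:R^-1) ?invr_ge0 ?(ltW n0)//.
rewrite ler_pdivrMl//.
apply: le_trans (ler_norm_sum _ _ _) _.
apply: (@le_trans _ _ (\sum_(k < d) (2 ^ n)%:R * (s * b))).
  apply: ler_sum => k _; apply: le_trans (ler_norm_sum _ _ _) _.
  apply: le_trans (ler_sum _ (fun e _ => le_b _ _)) _.
  by rewrite sumr_const card_ffun card_bool card_ord mulr_natl.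
by rewrite sumr_const card_ord -[leLHS]mulr_natl mulrCA.
Qed.

End SignedSums.

(** * Quadratic forms and norm bounds in a Hilbert space *)

Section Hilbert.
Variables (R : realType) (H : hilbertType R).
Local Notation C := (complex R).
Implicit Types (x y z : H) (T : {linear H -> H}).

Lemma innerC x y : inner x y = (inner y x)^*.
Proof. by rewrite hermC expr0 mul1r. Qed.

Lemma innerDl x y z : inner (x + y) z = inner x z + inner y z.
Proof. exact: linearDl. Qed.

Lemma innerDr x y z : inner x (y + z) = inner x y + inner x z.
Proof. exact: linearDr. Qed.

Lemma innerNl x y : inner (- x) y = - inner x y.
Proof. exact: linearNl. Qed.

Lemma innerNr x y : inner x (- y) = - inner x y.
Proof. exact: linearNr. Qed.

Lemma innerZl (a : C) x y : inner (a *: x) y = a * inner x y.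
Proof. exact: linearZl_LR. Qed.

Lemma innerZr (a : C) x y : inner x (a *: y) = a^* * inner x y.
Proof. exact: linearZr_LR. Qed.

Lemma inner_suml I (r : seq I) (F : I -> H) y :
  inner (\sum_(i <- r) F i) y = \sum_(i <- r) inner (F i) y.
Proof. exact: linear_sumlz. Qed.

(** Expanding the form at [x + z] shows that its cross terms have a real sum. The choices [z = y]
    and [z = 'i *: y] together give the claim. *)
Lemma real_form_selfadjoint T :
  (forall x, inner (T x) x \is Num.real) ->
  forall x y, inner (T x) y = inner x (T y).
Proof.
move=> hT x y; rewrite [RHS]innerC.
have cross z : inner (T x) z + inner (T z) x \is Num.real.
  have -> : inner (T x) z + inner (T z) x =
      inner (T (x + z)) (x + z) - inner (T x) x - inner (T z) z.
    by rewrite (linearD T) innerDl !innerDr; ring.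
  by rewrite !rpredB.
have /CrealP := cross y; have /CrealP := cross ('i *: y).
rewrite (linearZ_LR T) innerZl innerZr !rmorphD !rmorphM /= conjCi rmorphN /=
  conjCi.
set a := inner (T x) y; set b := inner (T y) x => e1 e2.
have e3 : a^* - b^* = b - a.
  apply: (mulfI (neq0Ci C)).
  have -> : 'i * (b - a) = - 'i * a + 'i * b by ring.
  by rewrite -e1; ring.
apply: (@mulIf _ (2 : C)); first by rewrite pnatr_eq0.
have -> : a * 2 = (a + b) - (b - a) by ring.
by rewrite -e2 -e3; ring.
Qed.

(** By self-adjointness, the forms at [x + t *: T x] and [x - t *: T x] differ by four times [t]
    times the squared norm of [T x]. The form bounds and the parallelogram law control this
    difference. *)
Lemma norm_le_of_form T (s : C) : 0 <= s ->
  (forall x, - (s * `|x| ^+ 2) <= inner (T x) x <= s * `|x| ^+ 2) ->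
  forall x, `|T x| <= s * `|x|.
Proof.
move=> s0 hT x.
have Treal z : inner (T z) z \is Num.real.
  have /andP[_ /ler_real ->] := hT z.
  by apply: ger0_real; rewrite mulr_ge0// exprn_ge0.
have Tsa := real_form_selfadjoint Treal.
(* Polarization along [x] and [t *: T x]. *)
have key (t : C) : 0 <= t ->
    2 * t * `|T x| ^+ 2 <= s * (`|x| ^+ 2 + t ^+ 2 * `|T x| ^+ 2).
  move=> t0; have tJ : t^* = t by apply/CrealP/ger0_real.
  have sub4 : 4 * t * `|T x| ^+ 2 =
      inner (T (x + t *: T x)) (x + t *: T x) -
      inner (T (x - t *: T x)) (x - t *: T x).
    rewrite (linearD T) (linearB T) (linearZ_LR T).
    rewrite !(innerDl, innerDr, innerNl, innerNr).
    rewrite !(innerZl, innerZr) tJ (Tsa (T x) x) inner_norm; ring.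
  have sum2 : `|x + t *: T x| ^+ 2 + `|x - t *: T x| ^+ 2 =
      2 * (`|x| ^+ 2 + t ^+ 2 * `|T x| ^+ 2).
    rewrite !inner_norm !(innerDl, innerDr, innerNl, innerNr).
    by rewrite !(innerZl, innerZr) tJ; ring.
  rewrite -(@ler_pM2l _ 2) ?ltr0n// [leRHS]mulrCA -sum2.
  have -> : 2 * (2 * t * `|T x| ^+ 2) = 4 * t * `|T x| ^+ 2 by ring.
  rewrite sub4 mulrDr; apply: lerD; first by have /andP[] := hT (x + t *: T x).
  by rewrite lerNl; have /andP[] := hT (x - t *: T x).
rewrite -(@ler_pXn2r _ 2) ?nnegrE ?mulr_ge0// exprMn.
have [s_eq0|sN0] := eqVneq s 0.
  have := key 1 ler01; rewrite s_eq0 !mul0r expr0n /= mul0r mulr1.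
  by rewrite pmulr_rle0// ltr0n.
(* With [t = s^-1], multiplying by [s] leaves two copies of the squared norm of [T x] on the left
   and one on the right, which cancels. *)
have := key s^-1; rewrite invr_ge0 => /(_ s0).
rewrite -(@ler_pM2l _ s) ?lt_def ?sN0//.
have -> : s * (2 * s^-1 * `|T x| ^+ 2) = `|T x| ^+ 2 + `|T x| ^+ 2 by field.
have -> : s * (s * (`|x| ^+ 2 + s^-1 ^+ 2 * `|T x| ^+ 2)) =
  s ^+ 2 * `|x| ^+ 2 + `|T x| ^+ 2 by field.
by rewrite lerD2r.
Qed.

(** Instead of Cauchy-Schwarz, the squared norm of [T x - s *: x] is expanded: its nonnegativity
    bounds [2 * s * inner (T x) x]. *)
Lemma form_le_of_norm T (s : C) : 0 <= s -> positive_op T ->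
  (forall x, `|T x| <= s * `|x|) ->
  forall x, inner (T x) x <= s * `|x| ^+ 2.
Proof.
move=> s0 Tpos hT x.
have [s_eq0|sN0] := eqVneq s 0.
  have := hT x; rewrite s_eq0 !mul0r normr_le0 => /eqP ->.
  by rewrite -(scale0r (0 : H)) innerZl !mul0r.
have sJ : s^* = s by apply/CrealP/ger0_real.
have TJ : inner x (T x) = inner (T x) x.
  by rewrite innerC; apply/CrealP/ger0_real/Tpos.
have : 0 <= `|T x - s *: x| ^+ 2 by rewrite exprn_ge0.
have -> : `|T x - s *: x| ^+ 2 =
    `|T x| ^+ 2 + s ^+ 2 * `|x| ^+ 2 - 2 * s * inner (T x) x.
  rewrite !inner_norm !(innerDl, innerDr, innerNl, innerNr).
  by rewrite !(innerZl, innerZr) sJ TJ; ring.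
rewrite subr_ge0 => le1.
have s2 : 0 < 2 * s by rewrite mulr_gt0 ?ltr0n// lt_def sN0.
rewrite -(ler_pM2l s2).
apply: le_trans le1 _.
have -> : 2 * s * (s * `|x| ^+ 2) =
    (s * `|x|) ^+ 2 + s ^+ 2 * `|x| ^+ 2 by ring.
by rewrite lerD2r (@ler_pXn2r _ 2) ?nnegrE ?mulr_ge0// hT.
Qed.

(** Positivity puts each signed term between plus and minus [inner (A i x) x], so the form of the
    plain sum dominates that of the signed one. The two preceding lemmas convert norm to form and
    back. *)
Lemma signed_sum_le (n : nat) (A : 'I_n -> {linear H -> H}) (s : C) :
  0 <= s -> (forall i, positive_op (A i)) ->
  (forall x, `|\sum_i A i x| <= s * `|x|) ->
  forall w x, `|signed_sum A w x| <= s * `|x|.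
Proof.
move=> s0 Apos hA w.
have hform x : \sum_i inner (A i x) x <= s * `|x| ^+ 2.
  have -> : \sum_i inner (A i x) x = inner (signed_sum A (fun=> false) x) x.
    by rewrite inner_suml; apply: eq_bigr => i _; rewrite innerZl mul1r.
  apply: form_le_of_norm => // y; first last.
    by rewrite /= /signed_sum; under eq_bigr do rewrite scale1r.
  by rewrite inner_suml sumr_ge0// => i _; rewrite innerZl mul1r Apos.
apply: norm_le_of_form => // x; rewrite /= /signed_sum inner_suml.
under eq_bigr do rewrite innerZl.
apply/andP; split.
  rewrite lerNl; apply: le_trans (hform x); rewrite -sumrN.
  apply: ler_sum => i _; case: (w i); rewrite ?mul1r ?mulN1r ?opprK//.
  by rewrite (le_trans (y := 0)) ?oppr_le0 ?Apos.
apply: le_trans (hform x); apply: ler_sum => i _.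
case: (w i); rewrite ?mul1r ?mulN1r//.
by rewrite (le_trans (y := 0)) ?oppr_le0 ?Apos.
Qed.

(** * The operator norm and the means *)

Lemma Re_norm x : (complex.Re `|x|)%:C%C = `|x|.
Proof. by rewrite RRe_real// normr_real. Qed.

Lemma opnorm_le (T : H -> H) (c : R) : 0 <= c ->
  (forall x, `|T x| <= c%:C%C * `|x|) -> opnorm T <= c.
Proof.
move=> c0 hT; apply: ge_sup.
  by exists (complex.Re `|T 0|), 0; rewrite /= ?normr0.
move=> _ [x /= x1 <-]; rewrite -lecR Re_norm; apply: le_trans (hT x) _.
by rewrite -[leRHS]mulr1 ler_wpM2l// ler0c.
Qed.

Lemma opnorm_ge0 (T : H -> H) : 0 <= opnorm T.
Proof.
(* For an arbitrary map the supremum may fail to exist; [sup] then has the default value 0. *)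
have [hs|/sup_out] := pselect (has_sup
    [set complex.Re `|T x| | x in [set x : H | `|x| <= 1]]%classic); last first.
  by rewrite /opnorm => ->.
apply: (@le_trans _ _ (complex.Re `|T 0|)).
  by rewrite -ler0c Re_norm.
by apply: sup_upper_bound => //; exists 0; rewrite /= ?normr0.
Qed.

(** The bound [M] ensures that the supremum in [opnorm] is a genuine one; homogeneity carries the
    estimate from unit vectors to all [x]. *)
Lemma norm_le_opnorm T (M : R) : (forall x, `|T x| <= M%:C%C * `|x|) ->
  forall x, `|T x| <= (opnorm T)%:C%C * `|x|.
Proof.
move=> hM x; have [->|x0] := eqVneq x 0; first by rewrite linear0 !normr0 mulr0.
have nx : 0 < `|x| by rewrite normr_gt0.
set y := `|x|^-1 *: x.
have y1 : `|y| = 1 by rewrite normrZ normfV normr_id mulVf// gt_eqF.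
have -> : `|T x| = `|T y| * `|x|.
  by rewrite /y linearZ normrZ normfV normr_id mulrAC mulVf ?mul1r// gt_eqF.
rewrite ler_wpM2r// -Re_norm lecR; apply: sup_upper_bound; last first.
  by exists y; rewrite /= ?y1.
split; first by exists (complex.Re `|T y|), y; rewrite /= ?y1.
exists (`|M|) => _ [z /= z1 <-]; rewrite -lecR Re_norm.
apply: le_trans (hM z) _.
apply: (@le_trans _ _ (`|M|%:C%C * `|z|)).
  by rewrite ler_wpM2r// lecR ler_norm.
by rewrite -[leRHS]mulr1 ler_wpM2l// ler0c.
Qed.

Lemma sum_bounded (n : nat) (A : 'I_n -> {linear H -> H}) :
  (forall i, bounded_op (A i)) ->
  exists M : R, forall x, `|\sum_i A i x| <= M%:C%C * `|x|.
Proof.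
move=> hA.
have /choice[M hM] : forall i, exists M : R,
    forall x, `|A i x| <= M%:C%C * `|x|.
  move=> i; have /linear_boundedP/pinfty_ex_gt0[M M0 hM] := hA i.
  by exists (complex.Re M) => x; rewrite RRe_real ?gtr0_real.
exists (\sum_i M i) => x; rewrite rmorph_sum mulr_suml.
by apply: le_trans (ler_norm_sum _ _ _) _; apply: ler_sum => i _; exact: hM.
Qed.

Lemma nc_meanE (n d : nat) (A : 'I_n -> {linear H -> H}) x :
  nc_mean d A x = ((n - d)`!%:R / n`!%:R : complex R) *:
    signed_inj_sum A (fun (_ : 'I_d) _ => false) x.
Proof.
rewrite /nc_mean /signed_inj_sum; congr (_ *: _).
rewrite fct_sumE; apply: eq_bigr => j _.
by rewrite big1 ?scale1r.
Qed.

Lemma nc_mean1E (n : nat) (A : 'I_n -> {linear H -> H}) x : (0 < n)%N ->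
  nc_mean 1 A x = (n%:R^-1 : complex R) *: \sum_i A i x.
Proof.
case: n A => // n A _; rewrite /nc_mean; congr (_ *: _).
  by rewrite subSS subn0 factS natrM invfM mulrCA divff ?mulr1// pnatr_eq0
     -lt0n fact_gt0.
rewrite fct_sumE (reindex (fun i : 'I_n.+1 => [ffun _ : 'I_1 => i])) /=.
  apply: eq_big => [i|i _]; last by rewrite big_ord_recl big_ord0 /= ffunE.
  by apply/injectiveP => k l _; rewrite !ord1.
exists (fun j : {ffun 'I_1 -> 'I_n.+1} => j ord0) => [i _|j _].
  by rewrite ffunE.
by apply/ffunP => k; rewrite ffunE (ord1 k).
Qed.

End Hilbert.

(** * The numerical constant and the final estimate *)

Lemma expn_fact_le_ffact (n d : nat) : (d <= n)%N ->
  (n ^ d * d`! <= d ^ d * n ^_ d)%N.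
Proof.
move=> dn; rewrite -ffactnn !ffact_prod.
rewrite -[X in (n ^ X)%N](card_ord d) -[X in (_ <= d ^ X * _)%N](card_ord d).
rewrite -!prod_nat_const -!big_split /=; apply: leq_prod => i _.
by rewrite !mulnBr [(d * n)%N]mulnC leq_sub2l// leq_mul2r dn orbT.
Qed.

Theorem theorem1p1 (R : realType) (H : hilbertType R) (n d : nat)
    (A : 'I_n -> {linear H -> H})
    (hd1 : (1 <= d)%N) (hdn : (d <= n)%N)
    (hbounded : forall i, bounded_op (A i))
    (hpositive : forall i, positive_op (A i)) :
  opnorm (nc_mean d A) `^ (d%:R^-1) <= d%:R * opnorm (nc_mean 1 A).
Proof.
have n0 : (0 < n)%N by apply: leq_trans hdn.
set p := opnorm (nc_mean 1 A).
have p0 : 0 <= p by exact: opnorm_ge0.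
have sum_le x : `|\sum_i A i x| <= (n%:R * p)%:C%C * `|x|.
  have [M hM] := sum_bounded hbounded.
  (* [norm_le_opnorm] needs a bundled linear map, so the mean is rebuilt from the signed sum with
     all signs positive. *)
  pose S := signed_sum A (fun=> false).
  have SE y : S y = \sum_i A i y.
    by apply: eq_bigr => i _; rewrite scale1r.
  pose T : {linear H -> H} := (n%:R^-1 : complex R) \*: S.
  have TE : nc_mean 1 A = T.
    by apply/funext => y; rewrite nc_mean1E// -SE.
  have nC : 0 < n%:R :> complex R by rewrite ltr0n.
  have hT y : `|T y| <= (n%:R^-1 * M)%:C%C * `|y|.
    have -> : T y = (n%:R^-1 : complex R) *: S y by [].
    rewrite normrZ SE rmorphM fmorphV rmorph_nat.
    by rewrite ger0_norm ?invr_ge0 ?(ltW nC)// -mulrA ler_pM2l ?invr_gt0.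
  have := norm_le_opnorm hT x; rewrite -TE -/p nc_mean1E// normrZ.
  rewrite ger0_norm ?invr_ge0 ?(ltW nC)// ler_pdivrMl//.
  by rewrite rmorphM rmorph_nat mulrA.
have s0 : 0 <= (n%:R * p)%:C%C :> complex R by rewrite ler0c mulr_ge0.
have le1 : opnorm (nc_mean d A) <= (d%:R * p) ^+ d.
  have dp0 : 0 <= (d%:R * p) ^+ d by rewrite exprn_ge0// mulr_ge0.
  apply: opnorm_le => // x; rewrite nc_meanE normrZ.
  have c0 : 0 <= (n - d)`!%:R / n`!%:R :> complex R by rewrite divr_ge0.
  rewrite ger0_norm//.
  have := signed_inj_sum_le s0 (signed_sum_le s0 hpositive sum_le).
  move=> /(_ d (fun _ _ => false) x) /(ler_wpM2l c0) /le_trans; apply.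
  rewrite mulrA ler_wpM2r// !rmorphXn !rmorphM !rmorph_nat.
  rewrite !exprMn !mulrA ler_wpM2r ?exprn_ge0 ?ler0c//.
  (* Cancelling [(n - d)!] against [n!] leaves [n ^_ d] in the denominator, and the claim becomes
     [expn_fact_le_ffact]. *)
  rewrite -(ffact_fact hdn) natrM.
  have f0 : (n - d)`!%:R != 0 :> complex R by rewrite pnatr_eq0 -lt0n fact_gt0.
  have g0 : 0 < (n ^_ d)%:R :> complex R by rewrite ltr0n ffact_gt0.
  rewrite invfM mulrCA divff// mulr1 -mulrA ler_pdivrMl//.
  rewrite -!natrX -!natrM ler_nat mulnC [leqRHS]mulnC.
  exact: expn_fact_le_ffact.
have d0 : d%:R != 0 :> R by rewrite pnatr_eq0 -lt0n.
have dp0 : 0 <= d%:R * p by rewrite mulr_ge0.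
(* The right-hand side becomes a [d]-th root too, so that monotonicity of the root applies to
   [le1]. *)
have -> : d%:R * p = ((d%:R * p) ^+ d) `^ d%:R^-1.
  by rewrite -powR_mulrn// -powRrM divff// powRr1.
by apply: ge0_ler_powR; rewrite ?nnegrE ?invr_ge0 ?opnorm_ge0// exprn_ge0.
Qed.
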